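(* Let $d\in\mathbb{N}$ and let $\chi:[0,1]^d\to C$ be a coloring of $[0,1]^d$ by an arbitrary set $C$ of colors such that no color includes points of opposite faces, i.e., for every color $c\in C$ and every coordinate $i\in\{1,\dots,d\}$, the set $\chi^{-1}(c)$ does not contain both a point with $i$-th coordinate $0$ and a point with $i$-th coordinate $1$. Then for any $\varepsilon\in(0,\tfrac12]$ there exists $\vec{p}\in[0,1]^d$ such that the open $\ell_\infty$ ball $\{\vec{x}\in\mathbb{R}^d:\|\vec{x}-\vec{p}\|_\infty<\varepsilon\}$ contains points (of $[0,1]^d$) of at least $\left(1+\frac23\varepsilon\right)^d$ different colors. *)

(* Defs.v *)
From HB Require Import structures.
From mathcomp Require Import all_boot all_order all_algebra.
From mathcomp Require Import all_classical all_reals all_analysis.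
Import Order.TTheory GRing.Theory Num.Theory.
Import numFieldNormedType.Exports.

Set Implicit Arguments.
Unset Strict Implicit.
Unset Printing Implicit Defensive.

Local Open Scope classical_set_scope.
Local Open Scope card_scope.
Local Open Scope ring_scope.

(* Points of R^d are row vectors; their library norm `|x| is the
   l_infinity norm (mx_norm). *)
Definition unit_cube (R : realType) (d : nat) : set 'rV[R]_d :=
  [set x | forall i : 'I_d, 0 <= x ord0 i <= 1].
Arguments unit_cube R d _ : clear implicits.

(* A coloring is a function on the subtype of points of the cube. *)
Definition no_color_on_opposite_faces (R : realType) (d : nat) (C : Type)
    (chi : unit_cube R d -> C) : Prop :=
  forall (c : C) (i : 'I_d),
    ~ ((exists x : unit_cube R d, chi x = c /\ set_val x ord0 i = 0) /\
       (exists y : unit_cube R d, chi y = c /\ set_val y ord0 i = 1)).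

Definition linf_ball (R : realType) (d : nat) (p : 'rV[R]_d) (e : R)
    : set 'rV[R]_d :=
  [set x | `|x - p| < e].

Definition colors_in (R : realType) (d : nat) (C : Type)
    (chi : unit_cube R d -> C) (B : set 'rV[R]_d) : set C :=
  chi @` [set x : unit_cube R d | B (set_val x)].

(* A may be infinite: "at least r elements" means that A contains n distinct
   elements for some natural number n >= r. *)
Definition at_least_elements (R : realType) (T : Type) (A : set T) (r : R)
    : Prop :=
  exists n : nat, r <= n%:R /\ `I_n #<= A.

(* Main.v *)
Require Import Defs.
From HB Require Import structures.
From mathcomp Require Import all_boot all_order all_algebra zify lra.
From mathcomp Require Import all_classical all_reals all_analysis.
Import Order.TTheory GRing.Theory Num.Theory.
Import numFieldNormedType.Exports.

(* Restrict the coloring to the grid of mesh 1/M, padded by k layers (k/M just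
   below eps) in every direction; a padding point gets the color of the nearest
   cube point.  As a color misses one of any two opposite faces, in each
   coordinate it occupies at most M + k of the M + 2k + 1 layers and leaves k
   free layers on one side.  Hence, on each line in that direction, thickening
   by k adds at least k points to at most M + k, so thickening a color class
   along the d coordinates, one after the other, multiplies its size by at least
   ((M + 2k) / (M + k)) ^ d.  By averaging, some grid point lies in that many
   thickened classes.  As M grows, the base tends to
   1 + eps / (1 + eps) >= 1 + 2/3 eps, and the limit is attained since the
   number of colors is an integer. *)

Set Implicit Arguments.
Unset Strict Implicit.
Unset Printing Implicit Defensive.

(** * Thickening subsets of a line *)

Definition grid (d n : nat) := {ffun 'I_d -> 'I_n.+1}.

Definition within (k a b : nat) := (a <= b + k) && (b <= a + k).

Definition thick1 (n k : nat) (S : {set 'I_n.+1}) : {set 'I_n.+1} :=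
  [set b : 'I_n.+1 | [exists a in S, within k a b]].

(** It suffices that [#|S| <= M + k] and [#|S| + k <= #|thick1 k S|], since then
    [#|S| * k <= k * (M + k)]. The [k] added points are those next to the extreme element of [S] on
    its free side. *)
Lemma card_thick1 (M k : nat) (S : {set 'I_(M + k.*2).+1}) :
  (forall a, a \in S -> k < a) \/ (forall a, a \in S -> a < M + k) ->
  #|S| * (M + k.*2) <= #|thick1 k S| * (M + k).
Proof.
have [->|[a0 Sa0]] := set_0Vmem S; first by rewrite cards0.
move=> HS.
suff [cS cT] : #|S| <= M + k /\ #|S| + k <= #|thick1 k S| by nia.
have sub : S \subset thick1 k S.
  apply/fintype.subsetP => a Sa; rewrite inE; apply/existsP; exists a.
  by rewrite Sa /within; lia.
have add_block (s : nat) : s + k <= (M + k.*2).+1 ->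
    (forall b : 'I_(M + k.*2).+1, s <= b < s + k ->
      b \notin S /\ b \in thick1 k S) ->
    #|S| + k <= #|thick1 k S|.
  move=> sk Hb.
  pose h (j : 'I_k) : 'I_(M + k.*2).+1 := inord (s + j).
  have hE j : h j = s + j :> nat by rewrite inordK //; have := ltn_ord j; lia.
  have h_inj : injective h.
    by move=> j j' /(congr1 val) /=; rewrite !hE => ?; apply: val_inj => /=; lia.
  have dis : S :&: h @: 'I_k = finset.set0.
    apply/finset.setP => b; rewrite !inE; apply/negP => /andP[Sb /imsetP[j _ bE]].
    have [|/negP//] := Hb b.
    by rewrite bE hE; have := ltn_ord j; lia.
  have -> : #|S| + k = #|S :|: h @: 'I_k|.
    by rewrite cardsU dis cards0 subn0 card_imset // card_ord.
  apply: subset_leq_card; rewrite finset.subUset sub /=.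
  apply/fintype.subsetP => b /imsetP[j _ bE].
  by have [|] := Hb b; rewrite // bE hE; have := ltn_ord j; lia.
have bound (s : nat) : s + (M + k) <= (M + k.*2).+1 ->
    (forall a : 'I_(M + k.*2).+1, a \in S -> s <= a < s + (M + k)) -> #|S| <= M + k.
  move=> sk Hs.
  (* [inord] needs a successor bound, which is one value too many; [ord_max] is never reached, so
     the image is proper and the bound sharp. *)
  pose h (a : 'I_(M + k.*2).+1) : 'I_(M + k).+1 := inord (a - s).
  have h_inj : {in S &, injective h}.
    move=> a b /Hs Ha /Hs Hb /(congr1 val) /=; rewrite !inordK; try lia.
    by move=> ?; apply: val_inj => /=; lia.
  rewrite -(card_in_imset h_inj) -ltnS.
  rewrite -[X in _ < X](card_ord (M + k).+1) -cardsT; apply: proper_card.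
  apply/properP; split; first exact: finset.subsetT.
  exists ord_max => //; apply/imsetP => -[a /Hs Ha /(congr1 val) /=].
  by rewrite inordK; lia.
case: HS => HS.
- split.
    apply: (bound k.+1) => [|a Sa]; first by lia.
    by have := HS a Sa; have := ltn_ord a; lia.
  have [m Sm mmin] := arg_minnP (fun a : 'I_(M + k.*2).+1 => a : nat) Sa0.
  have km := HS m Sm; have mL := ltn_ord m.
  apply: (add_block (m - k)); first by lia.
  move=> b Hb; split; first by apply/negP => /mmin; lia.
  by rewrite inE; apply/existsP; exists m; rewrite [m \in S]Sm /within; lia.
- split; first by apply: (bound 0) => [|a Sa]; [lia | have := HS a Sa; lia].
  have [m Sm mmax] := arg_maxnP (fun a : 'I_(M + k.*2).+1 => a : nat) Sa0.
  have mk := HS m Sm.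
  apply: (add_block m.+1); first by lia.
  move=> b Hb; split; first by apply/negP => /mmax; lia.
  by rewrite inE; apply/existsP; exists m; rewrite [m \in S]Sm /within; lia.
Qed.

(** * Thickening along the coordinates of the grid *)

Definition upd (d n : nat) (h : grid d n) (i : 'I_d) (a : 'I_n.+1) : grid d n :=
  [ffun j => if j == i then a else h j].

Definition fiber (d n : nat) (A : {set grid d n}) (i : 'I_d) (h : grid d n) :
    {set 'I_n.+1} :=
  [set a | upd h i a \in A].

(** Each line in direction [i] is indexed by its only point with [i]-th coordinate [ord0]. *)
Lemma card_fibers (d n : nat) (A : {set grid d n}) (i : 'I_d) :
  #|A| = \sum_(h : grid d n | h i == ord0) #|fiber A i h|.
Proof.
rewrite -sum1_card.
rewrite (partition_big (fun g => upd g i ord0) (fun h => h i == ord0)) /=; last first.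
  by move=> g _; rewrite ffunE eqxx.
apply: eq_bigr => h /eqP hi.
have updI : injective (upd h i).
  by move=> a b /ffunP/(_ i); rewrite !ffunE eqxx.
rewrite -(card_imset _ updI) -sum1_card; apply: eq_bigl => g.
apply/andP/imsetP => [[Ag /eqP gh]|[a]].
  have gE : upd h i (g i) = g.
    by apply/ffunP => j; rewrite -gh !ffunE; case: eqP => // ->.
  by exists (g i); rewrite ?inE gE.
rewrite inE => Aa ->; split=> //; apply/eqP/ffunP => j; rewrite !ffunE.
by case: eqP => // ->; rewrite hi.
Qed.

Definition thick (d n k : nat) (i : 'I_d) (A : {set grid d n}) :
    {set grid d n} :=
  [set q : grid d n | [exists a : 'I_n.+1, within k a (q i) && (upd q i a \in A)]].

Lemma card_thick (d M k : nat) (i : 'I_d) (A : {set grid d (M + k.*2)}) :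
  (forall g, g \in A -> k < g i) \/ (forall g, g \in A -> g i < M + k) ->
  #|A| * (M + k.*2) <= #|thick k i A| * (M + k).
Proof.
move=> HA; rewrite (card_fibers A i) (card_fibers (thick k i A) i) !big_distrl /=.
apply: leq_sum => h _; apply: (leq_trans (card_thick1 _)).
  by case: HA => HA; [left | right] => a; rewrite inE => /HA; rewrite ffunE eqxx.
rewrite leq_mul2r; apply/orP; right; apply: subset_leq_card.
apply/fintype.subsetP => b; rewrite !inE => /existsP[a /andP[]].
rewrite inE => Aa ab.
apply/existsP; exists a; rewrite ffunE eqxx ab /=.
suff -> : upd (upd h i b) i a = upd h i a by [].
by apply/ffunP => j; rewrite !ffunE; case: eqP.
Qed.

(** Induction on [s]: coordinates outside [s] are unchanged, so the one-sided bound on [A] in the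
    next direction passes to [B], and [card_thick] applies again. *)
Lemma exists_thick_along (d M k : nat) (A : {set grid d (M + k.*2)}) (s : seq 'I_d) :
  uniq s ->
  (forall i, (forall g, g \in A -> k < g i) \/
             (forall g, g \in A -> g i < M + k)) ->
  exists B : {set grid d (M + k.*2)},
    #|A| * (M + k.*2) ^ size s <= #|B| * (M + k) ^ size s /\
    forall q, q \in B -> exists2 g, g \in A &
      forall i, if i \in s then within k (g i) (q i) else q i == g i.
Proof.
move=> + HA; elim: s => [|i s IH] /=.
  by move=> _; exists A; split=> // q Aq; exists q.
case/andP => is_ /IH [B [cB HB]]; exists (thick k i B); split.
  rewrite !expnSr !mulnA.
  apply: (@leq_trans (#|B| * (M + k) ^ size s * (M + k.*2))).
    by rewrite leq_mul2r cB orbT.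
  rewrite mulnAC [leqRHS]mulnAC leq_mul2r card_thick ?orbT //.
  by case: (HA i) => H; [left|right] => q /HB [g Ag /(_ i)];
    rewrite (negbTE is_) => /eqP ->; apply: H.
move=> q; rewrite inE => /existsP[a /andP[aq /HB[g Ag Hg]]]; exists g => // j.
have := Hg j; rewrite inE ffunE; case: eqP => [->|_] /=; last by [].
by rewrite (negbTE is_) => /eqP <-.
Qed.

Lemma grid_neighborhood (d M k : nat) (I : finType) (f : grid d (M + k.*2) -> I) :
  (forall i (g h : grid d (M + k.*2)), g i <= k -> M + k <= h i -> f g <> f h) ->
  exists q : grid d (M + k.*2), (M + k.*2) ^ d <=
    #|[set c : I | [exists g : grid d (M + k.*2), (f g == c) &&
        [forall i, within k (g i) (q i)]]]| * (M + k) ^ d.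
Proof.
move=> Hf.
pose N (q : grid d (M + k.*2)) :=
  [set c : I | [exists g : grid d (M + k.*2), (f g == c) &&
    [forall i, within k (g i) (q i)]]].
apply/existsP; apply: contraT; rewrite negb_exists => /forallP Hlt.
have bound c : #|[set g : grid d (M + k.*2) | f g == c]| * (M + k.*2) ^ d
    <= #|[set q : grid d (M + k.*2) | c \in N q]| * (M + k) ^ d.
  have [i|B [cB HB]] := 
    exists_thick_along (A := [set g : grid d (M + k.*2) | f g == c])
      (enum_uniq 'I_d).
    have [/existsP[g /andP[/eqP fg gk]]|nlow] :=
      boolP [exists g : grid d (M + k.*2), (f g == c) && (g i <= k)].
      right=> h; rewrite inE => /eqP fh; rewrite ltnNge; apply/negP => hM.
      by apply: (Hf i g h gk hM); rewrite fg fh.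
    left=> h; rewrite inE => fh; rewrite ltnNge; apply: contra nlow => hk.
    by apply/existsP; exists h; rewrite fh.
  rewrite size_enum_ord in cB; apply: (leq_trans cB).
  rewrite leq_mul2r; apply/orP; right; apply: subset_leq_card.
  apply/fintype.subsetP => q /HB[g]; rewrite inE => fg Hg; rewrite !inE.
  apply/existsP; exists g; rewrite fg; apply/forallP => i.
  by have := Hg i; rewrite mem_enum.
(* Double counting of the pairs [(c, q)] with [c \in N q]. *)
have : \sum_c #|[set g : grid d (M + k.*2) | f g == c]| * (M + k.*2) ^ d <=
       \sum_(q : grid d (M + k.*2)) #|N q| * (M + k) ^ d.
  rewrite -!big_distrl /=; apply: leq_trans; last first.
    have -> : \sum_(q : grid d (M + k.*2)) #|N q| =
        \sum_c #|[set q : grid d (M + k.*2) | c \in N q]|.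
      transitivity (\sum_(q : grid d (M + k.*2)) \sum_c (c \in N q)).
        by apply: eq_bigr => q _; rewrite -sum1_card big_mkcond.
      rewrite exchange_big /=; apply: eq_bigr => c _.
      by rewrite -sum1_card [RHS]big_mkcond; apply: eq_bigr => q _; rewrite inE.
    rewrite big_distrl; apply: leq_sum => c _; exact: bound.
  by rewrite big_distrl.
rewrite -big_distrl /=.
have -> : \sum_c #|[set g : grid d (M + k.*2) | f g == c]| =
    \sum_(g : grid d (M + k.*2)) 1.
  rewrite (partition_big f xpredT) //=; apply: eq_bigr => c _.
  by rewrite -sum1_card; apply: eq_bigl => g; rewrite inE.
rewrite big_distrl /= leqNgt => /negP[].
(* The grid is nonempty: the term at [g0] makes the summed inequality strict. *)
have g0 : grid d (M + k.*2) := [ffun=> ord0].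
rewrite (bigD1 g0) //= [ltnRHS](bigD1 g0) //= -addSn; apply: leq_add.
  by rewrite mul1n ltnNge; exact: Hlt.
by apply: leq_sum => q _; rewrite mul1n ltnW // ltnNge; exact: Hlt.
Qed.

(** * Counting colors and choosing the mesh *)

Local Open Scope classical_set_scope.
Local Open Scope ring_scope.

Lemma card_le_image_finset (T : finType) (C : Type) (K : {set T}) (f : T -> C)
    (A : set C) :
  {in K &, injective f} -> (forall x, x \in K -> A (f x)) -> (`I_#|K| #<= A)%card.
Proof.
move=> f_inj fA; have [->|[x0 _]] := set_0Vmem K.
  by rewrite cards0 II0 card_ge0.
pose u j := f (nth x0 (enum K) j).
have uK j : (j < #|K|)%N -> nth x0 (enum K) j \in K.
  by move=> jK; rewrite -mem_enum mem_nth // -cardE.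
have u_inj : {in `I_#|K| &, injective u}.
  move=> i j /set_mem /= iK /set_mem /= jK /f_inj -/(_ (uK _ iK) (uK _ jK)) /eqP.
  by rewrite nth_uniq ?enum_uniq -?cardE // => /eqP.
rewrite -(card_le_eql (inj_card_eq u_inj)); apply: subset_card_le.
by move=> _ [j /= jK <-]; exact/fA/uK.
Qed.

Lemma exists_lt_expr (R : realType) (a b : R) (d : nat) :
  1 <= a -> b < a ^+ d -> exists2 x, 0 <= x < a & b < x ^+ d.
Proof.
move=> a1 ba.
have [e /= e0 He] : nbhs_ball a [set x : R | b < x ^+ d].
  apply/nbhs_ballP.
  exact: (@cvgr_gt _ _ _ _ _ _ (@exprn_continuous R d a) _ ba).
(* The cap at 1 keeps the witness nonnegative, since [1 <= a]. *)
exists (a - Num.min (e / 2) 1); last first.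
  apply: He; rewrite /ball /= opprB addrC subrK ger0_norm; last first.
    by rewrite le_min ler01 divr_ge0 // ltW.
  by rewrite gt_min; apply/orP; left; lra.
by case: (leP (e / 2) 1) => ?; lra.
Qed.

(** Put [a = 1 + 2/3 * eps]. Then [2/3 * eps * m < 2/3 * k + 1] and [2/3 * eps * k <= k / 3], so
    [a * (m + k) < m + 2 * k + 1]; the slack [(a - x) * m >= 1] absorbs the last 1. *)
Lemma mesh_ratio (R : realFieldType) (eps x m k : R) :
  0 <= k -> eps <= 1 / 2 -> x <= 1 + 2 / 3 * eps ->
  1 <= m * (1 + 2 / 3 * eps - x) -> eps * m - 1 / 2 < k + 1 ->
  x * (m + k) <= m + 2 * k.
Proof.
move=> k0 e2 xa mx km.
have h1 : 0 <= (1 + 2 / 3 * eps - x) * k by rewrite mulr_ge0 //; lra.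
have h2 : 0 <= (1 / 2 - eps) * k by rewrite mulr_ge0 //; lra.
lra.
Qed.

Lemma exists_mesh (R : realType) (d : nat) (eps : R) :
  0 < eps -> eps <= 1 / 2 -> exists M k : nat,
    [/\ (0 < M)%N, k%:R < eps * M%:R &
      forall N : nat, ((M + k.*2) ^ d <= N * (M + k) ^ d)%N ->
        (1 + 2 / 3 * eps) ^+ d <= N%:R].
Proof.
move=> e0 e2; set a := 1 + _.
have a1 : 1 <= a by rewrite /a; lra.
have ad0 : 0 < a ^+ d by rewrite exprn_gt0 //; lra.
have exn : exists n : nat, a ^+ d <= n%:R.
  by exists (Num.bound (a ^+ d)); rewrite ltW // archi_boundP // ltW.
(* An integer above [n - 1] is at least [n]. As [n - 1 < a ^+ d] is strict, some [x < a] still has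
   [n - 1 < x ^+ d], and it is enough to prove [x ^+ d <= N]. *)
have [n an nmin] := ex_minnP exn.
have n0 : (0 < n)%N by rewrite lt0n; apply/eqP => n0; move: an; rewrite n0 leNgt ad0.
have bn : n.-1%:R < a ^+ d.
  by rewrite ltNge; apply/negP => /nmin; lia.
have [x /andP[x0 xa] bx] := exists_lt_expr a1 bn.
have [M0 HM] : exists M : nat, (a - x)^-1 + eps^-1 < M%:R.
  exists (Num.bound ((a - x)^-1 + eps^-1)).
  by rewrite archi_boundP // addr_ge0 // invr_ge0; lra.
set m : R := M0%:R in HM.
have ax0 : 0 < (a - x)^-1 by rewrite invr_gt0; lra.
have ie0 : 0 < eps^-1 by rewrite invr_gt0.
have m0 : 0 < m by lra.
have mx : 1 <= m * (a - x) by rewrite -ler_pdivrMr ?div1r; lra.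
have me : 1 <= eps * m by rewrite mulrC -ler_pdivrMr // div1r; lra.
(* Subtracting 1/2 before truncating makes [k < eps * m] strict, as the open ball requires; the
   total loss stays below 3/2, which [mesh_ratio] tolerates. *)
have y0 : 0 <= eps * m - 1 / 2 by lra.
have /andP[k1 k2] := truncn_itv y0.
set k := Num.truncn _ in k1 k2; exists M0, k; split.
- by rewrite -(ltr_nat R).
- by rewrite -/m; lra.
move=> N HN; rewrite leNgt; apply/negP => Na.
have Nb : N%:R < x ^+ d.
  apply: le_lt_trans bx; rewrite ler_nat -ltnS prednK // -(ltr_nat R).
  exact: lt_le_trans an.
have k0 : 0 <= k%:R :> R by [].
have mk0 : 0 < m + k%:R by lra.
have : x ^+ d * (m + k%:R) ^+ d <= N%:R * (m + k%:R) ^+ d.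
  rewrite -exprMn; apply: (@le_trans _ _ ((m + 2 * k%:R) ^+ d)).
    rewrite lerXn2r ?nnegrE //; [by rewrite mulr_ge0 // ltW | by lra | ].
    by apply: (@mesh_ratio _ eps) => //; [exact: ltW | rewrite natr1].
  move: HN; rewrite -(ler_nat R) natrM !natrX !natrD -mul2n natrM; exact.
by rewrite ler_pM2r ?exprn_gt0 // leNgt Nb.
Qed.

(** * From the grid to the cube *)

Lemma rV_norm_lt (R : realType) (d : nat) (x : 'rV[R]_d) (e : R) :
  0 < e -> (forall i, `|x ord0 i| < e) -> `|x| < e.
Proof.
move=> e0 xe; rewrite [`|x|]mx_normrE.
by apply: bigmax_lt => // -[i j] _ /=; rewrite ord1.
Qed.

(** The clamp [minn (a - k) M], with truncated subtraction, is 1-Lipschitz in [a], also on the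
    padding. *)
Lemma dist_clamp (M k a b : nat) (R : realType) : (0 < M)%N -> within k a b ->
  `|(minn (a - k) M)%:R / M%:R - (minn (b - k) M)%:R / M%:R| <= k%:R / M%:R :> R.
Proof.
move=> M0 /andP[ab ba].
have Mp : 0 < M%:R^-1 :> R by rewrite invr_gt0 ltr0n.
rewrite -mulrBl normrM (gtr0_norm Mp) ler_pM2r // ler_norml.
have h1 : (minn (a - k) M <= k + minn (b - k) M)%N by lia.
have h2 : (minn (b - k) M <= k + minn (a - k) M)%N by lia.
by move: h1 h2; rewrite -!(ler_nat R) !natrD => h1 h2; apply/andP; split; lra.
Qed.

Theorem mainTheorem4 (R : realType) (d : nat) (C : Type)
    (chi : unit_cube R d -> C)
    (hchi : no_color_on_opposite_faces chi)
    (eps : R) (heps0 : 0 < eps) (heps1 : eps <= 1 / 2) :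
  exists p : 'rV[R]_d, unit_cube R d p /\
    at_least_elements (colors_in chi (linf_ball p eps))
      ((1 + 2 / 3 * eps) ^+ d).
Proof.
have [M [k [M0 kM HN]]] := exists_mesh d heps0 heps1.
have MR0 : 0 < M%:R :> R by rewrite ltr0n.
pose x (g : grid d (M + k.*2)) : 'rV[R]_d :=
  \row_i ((minn (g i - k) M)%:R / M%:R).
have x_cube g : unit_cube R d (x g).
  move=> i; rewrite mxE divr_ge0 //= ler_pdivrMr // mul1r ler_nat.
  exact: geq_minr.
pose X g : unit_cube R d := exist _ (x g) (mem_set (x_cube g)).
pose col g := chi (X g).
(* Colors have no decidable equality: each color is represented by a grid
   point carrying it. *)
pose f g := odflt g [pick h | `[< col h = col g >]].
have col_f g : col (f g) = col g.
  by rewrite /f; case: pickP => [h /asboolP|].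
have f_col g h : col g = col h -> f g = f h.
  move=> gh; rewrite /f gh; case: pickP => // /(_ h).
  by rewrite asboolT.
have [|q Hq] := @grid_neighborhood d M k _ f.
  (* Layers up to [k] are sent to the face 0 and layers from [M + k] on to the face 1. *)
  move=> i g h gk hM fgh.
  apply: (hchi (col g) i); split; [exists (X g) | exists (X h)]; split=> //.
  - rewrite /set_val /= mxE.
    by have -> : minn (g i - k) M = 0%N; [lia | rewrite mul0r].
  - by rewrite -/(col h) -(col_f h) -fgh col_f.
  - rewrite /set_val /= mxE.
    by have -> : minn (h i - k) M = M; [lia | rewrite divff // gt_eqF].
exists (x q); split; first exact: x_cube.
exists #|[set c | [exists g, (f g == c) && [forall i, within k (g i) (q i)]]]%SET|.
split; first exact: HN Hq.
(* [col] is injective on the values of [f], so counting representatives counts colors. *)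
apply: (@card_le_image_finset _ _ _ col).
  move=> c c'; rewrite !inE.
  move=> /existsP[g /andP[/eqP <- _]] /existsP[g' /andP[/eqP <- _]].
  by rewrite !col_f; exact: f_col.
move=> c; rewrite inE => /existsP[g /andP[/eqP <- /forallP gq]].
exists (X g); last by rewrite col_f.
rewrite /linf_ball /= /set_val /=; apply: rV_norm_lt => // i; rewrite !mxE.
apply: le_lt_trans (dist_clamp _ M0 (gq i)) _.
by rewrite ltr_pdivrMr.
Qed.
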